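(* Let $q\ge 2$, $A\in\mathbb{R}^{n\times n}$, and let $C_{ij}\in\mathbb{R}^{m_{ij}\times n}$ ($i,j\in\{1,\dots,q\}$) be matrices with $C_{ii}=0$. Assume: (1) $C_{ij}=C_{ji}$ for all $i,j$; (2) the graph $\mathcal{G}$ associated to $\{C_{ij}\}$ is connected; (3) $P\in\mathbb{R}^{n\times n}$ is a symmetric positive definite matrix such that $A^{T}P+PA<C_{ij}^{T}C_{ij}$ for all $i,j$ with $C_{ij}\neq 0$. Let $\alpha\ge (2q)^{-1}$ and $G_{ij}:=\alpha P^{-1}C_{ij}^{T}$. Define $$\varepsilon:=\min_{C_{ij}\neq 0}\lambda_{\min}(C_{ij}^{T}C_{ij}-A^{T}P-PA),\qquad \sigma:=\lambda_{\max}(A^{T}P+PA).$$ If $$\varepsilon>(\lambda_{2}(\Gamma)^{-1}-1)\,\sigma,$$ then the coupled systems $$\dot x_i=Ax_i+\sum_{j=1}^{q}G_{ij}C_{ij}(x_j-x_i),\qquad i=1,\dots,q,\quad x_i\in\mathbb{R}^n,$$ synchronize.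
   Context: The graph $\mathcal{G}=(\mathcal{V},\mathcal{E})$ associated to a set of matrices $\{C_{ij}\}$ has vertices $v_1,\dots,v_q$, and $(v_j,v_i)\in\mathcal{E}$ exactly when $C_{ij}\neq 0$; since $C_{ij}=C_{ji}$, the graph is undirected. The degree $d_i$ of $v_i$ is the number of edges of the form $(v_j,v_i)\in\mathcal{E}$. The unweighted normalized Laplacian $\Gamma=[\gamma_{ij}]\in\mathbb{R}^{q\times q}$ is given by $\gamma_{ij}=-1/q$ if $(v_j,v_i)\in\mathcal{E}$, $\gamma_{ii}=d_i/q$, and $\gamma_{ij}=0$ otherwise. For $\mathcal{G}$ undirected and connected, $\Gamma$ is symmetric positive semidefinite with a simple zero eigenvalue, and $\lambda_2(\Gamma)$ denotes its smallest nonzero eigenvalue. For symmetric matrices, $X<Y$ means $Y-X$ is positive definite; $\lambda_{\min},\lambda_{\max}$ denote the smallest and largest eigenvalues of a symmetric matrix. The systems are said to synchronize if $\|x_i(t)-x_j(t)\|\to0$ as $t\to\infty$ for all indices $i,j$ and all initial conditions. *)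

(* Defs.v *)
From HB Require Import structures.
From mathcomp Require Import all_boot all_order all_algebra.
From mathcomp Require Import all_classical all_reals all_analysis.
Set Implicit Arguments.
Unset Strict Implicit.
Unset Printing Implicit Defensive.
Import Order.TTheory GRing.Theory Num.Theory.
Import numFieldNormedType.Exports.
Local Open Scope classical_set_scope.
Local Open Scope ring_scope.

(* Both default to [point] when the set has no least (resp. greatest) element;
   they are only applied to nonempty finite sets of reals. *)
Definition least (R : realType) (S : set R) : R :=
  [get a | S a /\ lbound S a].

Definition greatest (R : realType) (S : set R) : R :=
  [get a | S a /\ ubound S a].

Definition lambda_min (R : realType) (n : nat) (M : 'M[R]_n) : R :=
  least [set a | eigenvalue M a].

Definition lambda_max (R : realType) (n : nat) (M : 'M[R]_n) : R :=
  greatest [set a | eigenvalue M a].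

Definition lambda2 (R : realType) (n : nat) (M : 'M[R]_n) : R :=
  least [set a | eigenvalue M a /\ a != 0].

Definition posdefmx (R : realType) (n : nat) (M : 'M[R]_n) : Prop :=
  M^T = M /\ forall v : 'cV[R]_n, v != 0 -> 0 < (v^T *m M *m v) 0 0.

Definition loewner_lt (R : realType) (n : nat) (X Y : 'M[R]_n) : Prop :=
  posdefmx (Y - X).

(* Equality of matrices whose numbers of rows are not definitionally equal;
   in particular the two numbers of rows coincide. *)
Definition eqmx_rows (R : realType) (m1 m2 n : nat)
    (M : 'M[R]_(m1, n)) (N : 'M[R]_(m2, n)) : Prop :=
  exists e : m1 = m2, castmx (e, erefl n) M = N.

(* [edge C j i] is the arc (v_j, v_i). *)
Definition edge (R : realType) (q n : nat) (m : 'I_q -> 'I_q -> nat)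
    (C : forall i j : 'I_q, 'M[R]_(m i j, n)) : rel 'I_q :=
  fun j i => C i j != 0.

Definition connected_graph (q : nat) (e : rel 'I_q) : Prop :=
  forall i j : 'I_q, connect e i j.

Definition degree (q : nat) (e : rel 'I_q) (i : 'I_q) : nat :=
  #|[pred j | e j i]|.

Definition laplacian (R : realType) (q : nat) (e : rel 'I_q) : 'M[R]_q :=
  \matrix_(i, j) if e j i then - (q%:R)^-1
                 else if i == j then (degree e i)%:R / q%:R
                 else 0.

Definition euclid_norm (R : realType) (n : nat) (v : 'cV[R]_n) : R :=
  Num.sqrt (\sum_(k < n) v k 0 ^+ 2).

(* Classical solutions on [0, +oo[ of the coupled systems. The derivative is
   two-sided, hence required for t > 0 only; together with continuity at 0 this
   also yields the right derivative at 0. *)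
Definition coupled_solution (R : realType) (q n : nat)
    (m : 'I_q -> 'I_q -> nat) (A : 'M[R]_n)
    (G : forall i j : 'I_q, 'M[R]_(n, m i j))
    (C : forall i j : 'I_q, 'M[R]_(m i j, n))
    (x0 : 'I_q -> 'cV[R]_n) (x : 'I_q -> R -> 'cV[R]_n) : Prop :=
  forall i : 'I_q,
    [/\ x i 0 = x0 i,
        {within [set t : R | 0 <= t], continuous (x i)} &
        forall t : R, 0 < t ->
          is_derive t 1 (x i)
            (A *m x i t + \sum_(j < q) G i j *m C i j *m (x j t - x i t))].

Definition synchronize (R : realType) (q n : nat)
    (m : 'I_q -> 'I_q -> nat) (A : 'M[R]_n)
    (G : forall i j : 'I_q, 'M[R]_(n, m i j))
    (C : forall i j : 'I_q, 'M[R]_(m i j, n)) : Prop :=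
  forall (x0 : 'I_q -> 'cV[R]_n) (x : 'I_q -> R -> 'cV[R]_n),
    coupled_solution A G C x0 x ->
    forall i j : 'I_q, euclid_norm (x i t - x j t) @[t --> +oo] --> (0 : R).

(* Main.v *)
Require Import Defs.
From HB Require Import structures.
From mathcomp Require Import all_boot all_order all_algebra.
From mathcomp Require Import all_classical all_reals all_analysis.
From mathcomp Require Import ring lra.
Import Order.TTheory GRing.Theory Num.Theory.
Import numFieldNormedType.Exports.
Local Open Scope classical_set_scope.
Local Open Scope ring_scope.

Set Implicit Arguments.
Unset Strict Implicit.
Unset Printing Implicit Defensive.

(** The Lyapunov function is the sum over all ordered pairs
    V = sum_{i,j} (x_i - x_j)^T P (x_i - x_j), which controls every difference
    x_i - x_j because P is positive definite.  Put S = A^T P + P A,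
    Q_ij = C_ij^T C_ij and y_ij = x_i - x_j.

    Since P G_ij C_ij = alpha Q_ij with Q symmetric in i and j, the coupling
    terms P u_i sum to zero, and summation by parts over the pairs gives
      V' = sum_{i,j} (y_ij^T S y_ij - 2 q alpha y_ij^T Q_ij y_ij)
    ([pair_energy_derivative]).  As 2 q alpha >= 1, each edge contributes at most
    - epsilon |y_ij|^2 and each other pair at most sigma |y_ij|^2.  So with
    T = sum_{i,j} |y_ij|^2 and E the same sum restricted to the edges,
      V' <= - epsilon E + sigma (T - E)      ([pair_energy_bound]).

    The graph enters through the Poincare inequality lambda2 T <= E
    ([lambda2_poincare]), applied coordinate by coordinate: on vectors whose
    entries sum to zero, the form of Gamma is bounded below by lambda2, and
    2 q v^T Gamma v = sum_{edges} (v_i - v_j)^2.  The hypothesis on epsilon is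
    what makes - epsilon E + sigma (T - E) <= - d T for some d > 0
    ([decay_rate]); hence V' <= - c V and V decays exponentially.

    All extremal eigenvalues are reached through one variational statement,
    [rayleigh_min]: a symmetric matrix minimizes its Rayleigh quotient on the
    orthogonal complement of part of its kernel, and the minimum is an
    eigenvalue.  With the zero subspace of the kernel it describes lambda_min
    and lambda_max, with the whole kernel it describes lambda2. *)

(** * Bilinear forms on column vectors *)

Definition bform (R : realType) (n : nat) (M : 'M[R]_n) (u v : 'cV[R]_n) : R :=
  (u^T *m M *m v) 0 0.

Definition dot (R : realType) (n : nat) : 'cV[R]_n -> 'cV[R]_n -> R :=
  bform 1%:M.

Section BilinearForm.
Context {R : realType} {n : nat}.
Implicit Types (M N : 'M[R]_n) (u v w : 'cV[R]_n) (a : R).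

Lemma bformE M u v :
  bform M u v = \sum_j \sum_i u i 0 * M i j * v j 0.
Proof.
rewrite /bform mxE; apply: eq_bigr => j _.
by rewrite mxE mulr_suml; apply: eq_bigr => i _; rewrite mxE.
Qed.

Lemma dotE u v : dot u v = \sum_i u i 0 * v i 0.
Proof.
by rewrite /dot /bform mulmx1 mxE; apply: eq_bigr => i _; rewrite mxE.
Qed.

Lemma bformBl M u v w : bform M (u - v) w = bform M u w - bform M v w.
Proof. by rewrite /bform linearB /= !mulmxBl !mxE. Qed.

Lemma bformDl M u v w : bform M (u + v) w = bform M u w + bform M v w.
Proof. by rewrite /bform linearD /= !mulmxDl !mxE. Qed.

Lemma bformZl M a u v : bform M (a *: u) v = a * bform M u v.
Proof. by rewrite /bform linearZ /= -!scalemxAl mxE. Qed.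

Lemma bformBr M u v w : bform M w (u - v) = bform M w u - bform M w v.
Proof. by rewrite /bform mulmxBr !mxE. Qed.

Lemma bformDr M u v w : bform M w (u + v) = bform M w u + bform M w v.
Proof. by rewrite /bform mulmxDr !mxE. Qed.

Lemma bformZr M a u v : bform M u (a *: v) = a * bform M u v.
Proof. by rewrite /bform -scalemxAr mxE. Qed.

Lemma bform0 M : bform M 0 0 = 0.
Proof. by rewrite /bform mulmx0 mxE. Qed.

Lemma bformD M N u v : bform (M + N) u v = bform M u v + bform N u v.
Proof. by rewrite /bform mulmxDr mulmxDl mxE. Qed.

Lemma bformN M u v : bform (- M) u v = - bform M u v.
Proof. by rewrite /bform mulmxN mulNmx mxE. Qed.

Lemma bform_mulmx M N u v : bform (M *m N) u v = bform M u (N *m v).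
Proof. by rewrite /bform !mulmxA. Qed.

Lemma bform_trmx M u v : bform M^T u v = bform M v u.
Proof.
rewrite /bform -[v^T *m M *m u]trmxK [in RHS]mxE.
by rewrite !trmx_mul !trmxK mulmxA.
Qed.

Lemma bform_dot M u v : bform M u v = dot u (M *m v).
Proof. by rewrite /dot -bform_mulmx mul1mx. Qed.

Lemma dot_ge0 u : 0 <= dot u u.
Proof. by rewrite dotE; apply: sumr_ge0 => i _; rewrite -expr2 sqr_ge0. Qed.

Lemma dot_eq0 u : (dot u u == 0) = (u == 0).
Proof.
apply/idP/eqP => [|->]; last by rewrite /dot bform0.
rewrite dotE psumr_eq0 => [/allP u0|i _]; last by rewrite -expr2 sqr_ge0.
apply/colP => i; rewrite mxE; apply/eqP.
by have := u0 i (mem_index_enum _); rewrite mulf_eq0 orbb.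
Qed.

Lemma dot_gt0 u : u != 0 -> 0 < dot u u.
Proof. by move=> u0; rewrite lt_neqAle eq_sym dot_eq0 u0 dot_ge0. Qed.

End BilinearForm.

Lemma gram_psd (R : realType) (n p : nat) (K : 'M[R]_(n, p)) (u : 'cV[R]_n) :
  bform (K *m K^T) u u = dot (K^T *m u) (K^T *m u).
Proof. by rewrite /dot /bform mulmx1 trmx_mul trmxK !mulmxA. Qed.

(** * Rayleigh quotients and extremal eigenvalues *)

Lemma continuous_bform (R : realType) (n : nat) (M : 'M[R]_n) :
  continuous (fun w : 'rV[R]_n => bform M w^T w^T).
Proof.
under eq_fun do rewrite bformE.
apply: continuous_big => [|j _]; first exact: add_continuous.
apply: continuous_big => [|i _ w]; first exact: add_continuous.
have c k : x^T k 0 @[x --> w] --> w^T k 0.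
  by under eq_fun do rewrite mxE; rewrite mxE; exact: coord_continuous.
by apply: cvgM (c j); apply: cvgM (c i) _; exact: cvg_cst.
Qed.

(** The first-order condition at the minimum [t = 0]: a short step against the
    sign of a nonzero [b] would make the polynomial negative. *)
Lemma linear_term0 (R : realType) (b c : R) :
  0 <= c -> (forall t : R, 0 <= 2 * t * b + t ^+ 2 * c) -> b = 0.
Proof.
(* The denominator is nonzero and makes the step short enough. *)
move=> c0 /(_ (- b / (c + 1))) h.
have c1 : c + 1 != 0 by lra.
have e : 2 * (- b / (c + 1)) * b + (- b / (c + 1)) ^+ 2 * c
   = - (b ^+ 2 * (c + 2) / (c + 1) ^+ 2) by field.
rewrite e oppr_ge0 in h.
have d0 : 0 < (c + 1) ^+ 2 by apply: exprn_gt0; lra.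
rewrite ler_pdivrMr // mul0r pmulr_lle0 in h; last by lra.
by apply/eqP; rewrite -sqrf_eq0 eq_le h sqr_ge0.
Qed.

(** Minimizing [bform M] over the unit sphere of the orthogonal complement of
    the columns of [K] yields an eigenvector: at a minimizer [v] of value [mu]
    the form of [B = M - mu] is nonnegative on the complement and vanishes at
    [v], so [B v] is orthogonal to the complement.  But [B v] itself lies there,
    because [M] kills [K]; hence [B v = 0]. *)
Lemma rayleigh_min (R : realType) (n p : nat) (M : 'M[R]_n) (K : 'M[R]_(n, p)) :
  M^T = M -> M *m K = 0 ->
  (exists2 v : 'cV[R]_n, v != 0 & K^T *m v = 0) ->
  exists mu (v : 'cV[R]_n), [/\ v != 0, K^T *m v = 0, M *m v = mu *: v &
    forall w, K^T *m w = 0 -> mu * dot w w <= bform M w w].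
Proof.
move=> symM MK [v0 v0n0 Kv0].
(* Orthogonality to [K] is written as the vanishing of one continuous form, so
   that the constraint set is visibly closed. *)
pose S := [set w : 'rV[R]_n | bform (K *m K^T) w^T w^T = 0
                            /\ dot w^T w^T = 1].
have KP w : bform (K *m K^T) w w = 0 <-> K^T *m w = 0.
  rewrite gram_psd; split => [/eqP|->]; last by rewrite /dot bform0.
  by rewrite dot_eq0 => /eqP.
have normalize (w : 'cV[R]_n) : w != 0 -> K^T *m w = 0 ->
    exists a : R, S (a *: w)^T.
  move=> w0 Kw; exists (Num.sqrt (dot w w))^-1.
  split; rewrite trmxK; first by apply/KP; rewrite -scalemxAr Kw scaler0.
  rewrite /dot bformZl bformZr mulrA -expr2 exprVn sqr_sqrtr ?dot_ge0//.
  by rewrite mulVf// dot_eq0.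
have S0 : S !=set0 by have [a Sa] := normalize _ v0n0 Kv0; exists (a *: v0)^T.
have cS : compact S.
  apply: (@subclosed_compact _ _
    [set w : 'rV[R]_n | forall i, (fun=> `[-1, 1]%classic) i (w ord0 i)]).
  - have -> : S = [set w | bform (K *m K^T) w^T w^T = 0] `&`
                  [set w | dot w^T w^T = 1] by [].
    apply: closedI.
      apply: (@preimage_closed _ _ (fun w : 'rV[R]_n => bform (K *m K^T) w^T w^T)
        [set 0]) => [w _|]; [exact: continuous_bform | exact: closed_eq].
    apply: (@preimage_closed _ _ (fun w : 'rV[R]_n => dot w^T w^T)
        [set 1]) => [w _|]; [exact: continuous_bform | exact: closed_eq].
  - exact: (@rV_compact R n (fun=> `[-1, 1]%classic)
      (fun=> @segment_compact R (-1) 1)).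
  - move=> w [_ w1] i /=; rewrite in_itv/=.
    have : w 0 i ^+ 2 <= 1.
      rewrite -w1 dotE (bigD1 i)//= !mxE -expr2 lerDl.
      by apply: sumr_ge0 => j _; rewrite -expr2 sqr_ge0.
    by rewrite !ord1 => wi; apply/andP; split; nra.
have [v vS vmin] := compact_EVT_min S0 cS
  (continuous_subspaceT (@continuous_bform _ _ M)).
move: vS; rewrite inE => -[/KP Kv v1].
pose mu := bform M v^T v^T.
have mu_le w : K^T *m w = 0 -> mu * dot w w <= bform M w w.
  move=> Kw; have [->|w0] := eqVneq w 0.
    by rewrite /dot !bform0 mulr0.
  have [a Sa] := normalize w w0 Kw.
  have := vmin _ (mem_set Sa).
  case: Sa => _; rewrite trmxK /dot !(bformZl, bformZr) !mulrA -!expr2 -/(dot _ _).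
  rewrite -/mu => d1 /(ler_wpM2r (dot_ge0 w)).
  by rewrite mulrAC d1 mul1r.
exists mu, v^T; split => //.
- apply: contra_eq_neq v1 => ->; rewrite /dot bform0.
  by rewrite eq_sym oner_eq0.
pose B := M - mu%:M.
have BE u w : bform B u w = bform M u w - mu * dot u w.
  by rewrite bformD bformN /dot -bformZr -[mu *: w]mul_scalar_mx
             -[in RHS]bform_mulmx mul1mx.
have symB : B^T = B by rewrite linearB /= symM tr_scalar_mx.
have Bmin w : K^T *m w = 0 -> bform B v^T w = 0.
  move=> Kw; apply: (@linear_term0 _ _ (bform B w w)).
    by rewrite BE subr_ge0 mu_le.
  move=> t; have : 0 <= bform B (v^T + t *: w) (v^T + t *: w).
    by rewrite BE subr_ge0 mu_le// mulmxDr -scalemxAr Kv Kw scaler0 addr0.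
  have Bvv : bform B v^T v^T = 0 by rewrite BE v1 mulr1 subrr.
  rewrite !(bformDl, bformDr, bformZl, bformZr) Bvv -(bform_trmx B w) symB.
  by congr (_ <= _); ring.
have : bform B v^T (B *m v^T) = 0.
  apply: Bmin; rewrite mulmxA /B mulmxBr mulmxBl mul_mx_scalar -scalemxAl Kv.
  have -> : K^T *m M = 0 by rewrite -[M]symM -trmx_mul MK trmx0.
  by rewrite mul0mx scaler0 subrr.
rewrite -bform_trmx symB bform_dot => /eqP; rewrite dot_eq0 /B mulmxBl.
by rewrite mul_scalar_mx subr_eq0 => /eqP.
Qed.

Lemma least_eq (R : realType) (S : set R) (a : R) :
  S a -> lbound S a -> least S = a.
Proof.
move=> Sa la; apply: get_unique => // b [Sb lb].
by apply/eqP; rewrite eq_le la// lb.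
Qed.

Lemma least_finite_image (R : realType) (T : finType) (S : pred T) (f : T -> R) :
  (exists i, S i) ->
  (exists2 i, S i & least [set f i | i in [set i | S i]] = f i) /\
  forall i, S i -> least [set f i | i in [set i | S i]] <= f i.
Proof.
case=> i0 Si0; case: (arg_minP f Si0) => i Si fi_le.
rewrite (least_eq (a := f i)); first by split; [exists i|].
  by exists i.
by move=> _ [j Sj <-]; exact: fi_le.
Qed.

Lemma greatest_eq (R : realType) (S : set R) (a : R) :
  S a -> ubound S a -> greatest S = a.
Proof.
move=> Sa ua; apply: get_unique => // b [Sb ub].
by apply/eqP; rewrite eq_le ub// ua.
Qed.

(** [eigenvalue] speaks of row eigenvectors; symmetry turns them into columns. *)
Lemma eigenvalue_symP (R : realType) (n : nat) (M : 'M[R]_n) (a : R) :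
  M^T = M ->
  eigenvalue M a <-> exists2 v : 'cV[R]_n, v != 0 & M *m v = a *: v.
Proof.
move=> symM; split => [/eigenvalueP[v vM v0]|[v v0 Mv]].
  exists v^T; first by rewrite trmx_eq0.
  by apply: trmx_inj; rewrite trmx_mul symM trmxK linearZ /= trmxK.
apply/eigenvalueP; exists v^T; last by rewrite trmx_eq0.
by rewrite -[M]symM -trmx_mul Mv linearZ.
Qed.

Lemma eigenvector_bform (R : realType) (n : nat) (M : 'M[R]_n) (a : R) v :
  M *m v = a *: v -> bform M v v = a * dot v v.
Proof. by move=> Mv; rewrite bform_dot Mv /dot bformZr. Qed.

Lemma lambda_minP (R : realType) (n : nat) (M : 'M[R]_n) :
  (0 < n)%N -> M^T = M ->
  (exists2 v : 'cV[R]_n, v != 0 & M *m v = lambda_min M *: v) /\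
  forall w, lambda_min M * dot w w <= bform M w w.
Proof.
move=> n0 symM.
have [||mu [v [v0 _ Mv mu_le]]] := @rayleigh_min R n 1 M 0 symM.
- by rewrite mulmx0.
- exists (const_mx 1); last by rewrite trmx0 mul0mx.
  apply/eqP => /colP/(_ (Ordinal n0)); rewrite !mxE => /eqP.
  by rewrite oner_eq0.
have {}mu_le w : mu * dot w w <= bform M w w.
  by apply: mu_le; rewrite trmx0 mul0mx.
suff -> : lambda_min M = mu by split => //; exists v.
apply: least_eq => [|a /= /(eigenvalue_symP _ symM)[w w0 Mw]].
  by apply/(eigenvalue_symP _ symM); exists v.
by rewrite -(ler_pM2r (dot_gt0 w0)) -(eigenvector_bform Mw).
Qed.

Lemma bform_le_lambda_max (R : realType) (n : nat) (M : 'M[R]_n) :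
  (0 < n)%N -> M^T = M -> forall w, bform M w w <= lambda_max M * dot w w.
Proof.
move=> n0 symM w.
have symN : (- M)^T = - M by rewrite linearN /= symM.
have [[v v0 Nv] min_le] := lambda_minP n0 symN.
have max_ge u : bform M u u <= - lambda_min (- M) * dot u u.
  by have := min_le u; rewrite bformN; lra.
suff -> : lambda_max M = - lambda_min (- M) by [].
apply: greatest_eq => [|a /= /(eigenvalue_symP _ symM)[u u0 Mu]].
  apply/(eigenvalue_symP _ symM); exists v => //.
  by rewrite scaleNr -Nv mulNmx opprK.
by rewrite -(ler_pM2r (dot_gt0 u0)) -(eigenvector_bform Mu).
Qed.

Lemma posdef_lambda_min_gt0 (R : realType) (n : nat) (M : 'M[R]_n) :
  (0 < n)%N -> posdefmx M -> 0 < lambda_min M.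
Proof.
move=> n0 [symM posM]; have [[v v0 Mv] _] := lambda_minP n0 symM.
by rewrite -(pmulr_lgt0 _ (dot_gt0 v0)) -(eigenvector_bform Mv) posM.
Qed.

Lemma posdef_unitmx (R : realType) (n : nat) (P : 'M[R]_n) :
  posdefmx P -> P \in unitmx.
Proof.
move=> [symP posP]; rewrite -row_free_unit; apply/inj_row_free => v vP.
apply/eqP; rewrite -trmx_eq0; apply/negP => /negP /posP.
by rewrite trmxK vP mul0mx mxE ltxx.
Qed.

(** When the columns of [K] span the kernel of [M], an eigenvector for a nonzero
    eigenvalue is orthogonal to [K]; so the least nonzero eigenvalue is the
    minimum of the Rayleigh quotient on that complement. *)
Lemma lambda2P (R : realType) (n p : nat) (M : 'M[R]_n) (K : 'M[R]_(n, p)) :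
  M^T = M -> M *m K = 0 ->
  (forall v : 'cV[R]_n, M *m v = 0 -> K^T *m v = 0 -> v = 0) ->
  (exists2 v : 'cV[R]_n, v != 0 & K^T *m v = 0) ->
  [/\ lambda2 M != 0,
      exists2 v : 'cV[R]_n, v != 0 & M *m v = lambda2 M *: v &
      forall w, K^T *m w = 0 -> lambda2 M * dot w w <= bform M w w].
Proof.
move=> symM MK kerM exv.
have [mu [v [v0 Kv Mv mu_le]]] := rayleigh_min symM MK exv.
have mu0 : mu != 0.
  apply: contra_neq v0 => mu0; apply: kerM => //.
  by rewrite Mv mu0 scale0r.
suff -> : lambda2 M = mu by split => //; exists v.
apply: least_eq => [|a /= [/(eigenvalue_symP _ symM)[w w0 Mw] a0]].
  by split=> //; apply/(eigenvalue_symP _ symM); exists v.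
rewrite -(ler_pM2r (dot_gt0 w0)) -(eigenvector_bform Mw) mu_le//.
apply: (scalerI a0); rewrite scaler0 scalemxAr -Mw mulmxA -[M]symM -trmx_mul.
by rewrite MK trmx0 mul0mx.
Qed.

(** * Summation by parts over pairs of agents *)

Section PairSums.
Context {R : realType} {I : finType} {V : zmodType}.
Variable b : V -> {additive V -> R}.
Hypothesis bBl : forall u v w, b (u - v) w = b u w - b v w.

(** Exchanging [i] and [j] turns the part with [x j] into the part with [x i],
    the antisymmetry of [F] absorbing the sign. *)
Lemma sum_antisym (x : I -> V) (F : I -> I -> V) :
  (forall i j, F j i = - F i j) ->
  \sum_i \sum_j b (x i - x j) (F i j) = 2 * \sum_i b (x i) (\sum_j F i j).
Proof.
move=> FN.
under eq_bigr do under eq_bigr do rewrite bBl.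
under eq_bigr do rewrite big_split /= sumrN -raddf_sum.
rewrite big_split /= sumrN exchange_big /=.
under [X in _ - X]eq_bigr do under eq_bigr do rewrite FN raddfN.
under [X in _ - X]eq_bigr do rewrite sumrN -raddf_sum.
by rewrite sumrN opprK mulr_natl mulr2n.
Qed.

(** The polarized variance identity, for a centred family [z]. *)
Lemma sum_pairwise_diff (x z : I -> V) : \sum_j z j = 0 ->
  \sum_i \sum_j b (x i - x j) (z i - z j) = 2 * #|I|%:R * \sum_i b (x i) (z i).
Proof.
move=> z0; rewrite (@sum_antisym x (fun i j => z i - z j)) => [|i j].
  rewrite -mulrA; congr (_ * _); rewrite mulr_sumr; apply: eq_bigr => i _.
  by rewrite big_split /= sumrN z0 subr0 sumr_const raddfMn mulr_natl.
by rewrite opprB.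
Qed.

End PairSums.

HB.instance Definition _ (R : realType) (n : nat) (M : 'M[R]_n) (u : 'cV[R]_n) :=
  GRing.isZmodMorphism.Build 'cV[R]_n R (bform M u) (fun v w => bformBr M v w u).

(** * The Laplacian of a connected graph *)

Section Laplacian.
Context {R : realType} {q : nat}.
Variable e : rel 'I_q.
Hypotheses (e_sym : symmetric e) (e_irr : irreflexive e).
Implicit Types v : 'cV[R]_q.

Let Gamma := laplacian R e.

Lemma laplacian_sym : Gamma^T = Gamma.
Proof.
apply/matrixP => i j; rewrite !mxE e_sym; case: (e j i) => //.
by case: eqVneq => [->|]; rewrite ?eqxx // eq_sym => /negbTE ->.
Qed.

Lemma laplacian_mul v (i : 'I_q) :
  q%:R * (Gamma *m v) i 0 = \sum_j (e i j)%:R * (v i 0 - v j 0).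
Proof.
have q0 : q%:R != 0 :> R by rewrite pnatr_eq0; case: q i => [[]|].
rewrite mxE mulr_sumr.
transitivity (\sum_j ((i == j)%:R * (degree e i)%:R * v j 0 - (e i j)%:R * v j 0)).
  apply: eq_bigr => j _; rewrite mxE (e_sym j i).
  case: eqVneq => [<-|ij]; rewrite ?e_irr /=; first by field.
  by case: (e i j) => /=; field.
rewrite sumrB /= (bigD1 i)//= eqxx big1 => [|j /negbTE ji]; last first.
  by rewrite eq_sym ji !mul0r.
rewrite mul1r addr0 /degree -sum1_card natr_sum big_mkcond mulr_suml -sumrB.
apply: eq_bigr => j _; rewrite inE e_sym.
by case: (e i j) => /=; ring.
Qed.

Lemma laplacian_energy v :
  2 * q%:R * bform Gamma v v
  = \sum_i \sum_j (e i j)%:R * (v i 0 - v j 0) ^+ 2.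
Proof.
transitivity (\sum_i \sum_j (v i 0 - v j 0) * ((e i j)%:R * (v i 0 - v j 0))).
  (* The product of [R], seen as a family of additive maps. *)
  rewrite (@sum_antisym _ _ R
    (fun a => (a \*o idfun : {additive R -> R})) _ (fun i => v i 0)
    (fun i j => (e i j)%:R * (v i 0 - v j 0))) => [|u w z|i j]; last 2 first.
  - by rewrite /= mulrBl.
  - by rewrite e_sym -mulrN opprB.
  rewrite -mulrA bform_dot dotE mulr_sumr; congr (_ * _).
  by apply: eq_bigr => i _; rewrite /= -laplacian_mul; ring.
by apply: eq_bigr => i _; apply: eq_bigr => j _; ring.
Qed.

Hypothesis e_conn : connected_graph e.

(** A vector of zero energy takes equal values at the ends of every edge, hence
    along every path. *)
Lemma laplacian_kernel v : bform Gamma v v = 0 -> forall i j, v i 0 = v j 0.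
Proof.
move=> v0; have := laplacian_energy v; rewrite v0 mulr0 => /esym/eqP E0.
have terms_ge0 i j : 0 <= (e i j)%:R * (v i 0 - v j 0) ^+ 2.
  by rewrite mulr_ge0 ?ler0n ?sqr_ge0.
have edge_eq i j : e i j -> v i 0 = v j 0.
  move=> eij; move: E0; rewrite psumr_eq0 => [|k _]; last exact: sumr_ge0.
  move=> /allP/(_ i (mem_index_enum _)) /=.
  rewrite psumr_eq0 // => /allP/(_ j (mem_index_enum _)) /=.
  by rewrite eij mul1r sqrf_eq0 subr_eq0 => /eqP.
move=> i j; have /connectP[p ep ->] := e_conn i j.
elim: p i ep => //= k p IH i /andP[/edge_eq -> /IH].
by [].
Qed.

(** By connectedness the kernel of the Laplacian is spanned by the all-ones
    vector, whose orthogonal complement is the set of centred vectors; it is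
    nonzero because there are at least two vertices. *)
Lemma laplacian_lambda2 : (2 <= q)%N ->
  0 < lambda2 Gamma /\
  forall v, \sum_i v i 0 = 0 -> lambda2 Gamma * dot v v <= bform Gamma v v.
Proof.
move=> hq; pose ones : 'cV[R]_q := const_mx 1.
have q0 : 0 < q%:R :> R by rewrite ltr0n ltnW.
have onesE v : ones^T *m v = (\sum_i v i 0)%:M.
  apply/matrixP => i j; rewrite !ord1 mxE [RHS]mxE eqxx mulr1n.
  by apply: eq_bigr => k _; rewrite !mxE mul1r.
have onesP v : \sum_i v i 0 = 0 <-> ones^T *m v = 0.
  rewrite onesE; split => [->|/matrixP/(_ 0 0)];
    first by rewrite raddf0.
  by rewrite !mxE.
have Gamma_ones : Gamma *m ones = 0.
  apply/colP => i; have := laplacian_mul ones i.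
  rewrite big1 => [/eqP|j _]; last by rewrite !mxE subrr mulr0.
  by rewrite mulf_eq0 gt_eqF //= => /eqP ->; rewrite mxE.
have [||l0 [v v0 Gv] l_le] := lambda2P laplacian_sym Gamma_ones.
- move=> v Gv /onesP v0.
  have cst : forall i j, v i 0 = v j 0.
    by apply: laplacian_kernel; rewrite bform_dot Gv /dot raddf0.
  apply/colP => i; rewrite mxE; apply/eqP.
  move: v0; under eq_bigr do rewrite (cst _ i).
  rewrite sumr_const card_ord -mulr_natl => /eqP.
  by rewrite mulf_eq0 gt_eqF.
- pose i0 : 'I_q := Ordinal (ltnW hq); pose i1 : 'I_q := Ordinal hq.
  exists (delta_mx i0 0 - delta_mx i1 0).
    apply/eqP => /colP/(_ i0); rewrite !mxE !eqxx /= => /eqP.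
    by rewrite subr0 oner_eq0.
  apply/onesP; under eq_bigr do rewrite !mxE eqxx !andbT.
  have sum1 k : \sum_(i < q) (i == k)%:R = 1 :> R.
    by rewrite (bigD1 k)//= eqxx big1 ?addr0// => i /negbTE ->.
  by rewrite sumrB !sum1 subrr.
split; last by move=> w /onesP /l_le.
rewrite lt_neqAle eq_sym l0 -(pmulr_lge0 _ (dot_gt0 v0)) -(eigenvector_bform Gv).
rewrite -(pmulr_rge0 _ (mulr_gt0 (ltr0Sn R 1) q0)) laplacian_energy.
apply: sumr_ge0 => i _; apply: sumr_ge0 => j _.
by rewrite mulr_ge0 ?ler0n ?sqr_ge0.
Qed.

(** Both sides split over the [n] coordinates and only see differences, so the
    claim reduces to centred scalar families; there the left-hand double sum is
    [2 q] times the squared norm and the right-hand one [2 q] times the Laplacian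
    form. *)
Lemma lambda2_poincare (hq : (2 <= q)%N) (n : nat) (x : 'I_q -> 'cV[R]_n) :
  lambda2 Gamma * (\sum_i \sum_j dot (x i - x j) (x i - x j))
  <= \sum_i \sum_j (e i j)%:R * dot (x i - x j) (x i - x j).
Proof.
have [_ l_le] := laplacian_lambda2 hq.
have q0 : 0 < q%:R :> R by rewrite ltr0n ltnW.
have scalar_case (y : 'I_q -> R) :
    lambda2 Gamma * (\sum_i \sum_j (y i - y j) ^+ 2)
    <= \sum_i \sum_j (e i j)%:R * (y i - y j) ^+ 2.
  pose mean := q%:R^-1 * \sum_i y i.
  pose v : 'cV[R]_q := \col_i (y i - mean).
  have vE i : v i 0 = y i - mean by rewrite mxE.
  have v0 : \sum_i v i 0 = 0.
    under eq_bigr do rewrite vE.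
    rewrite sumrB sumr_const card_ord -mulr_natl /mean mulrA mulfV ?gt_eqF//.
    by rewrite mul1r subrr.
  have yE i j : y i - y j = v i 0 - v j 0 by rewrite !vE; ring.
  under [X in _ * X]eq_bigr do under eq_bigr do rewrite yE expr2.
  rewrite (@sum_pairwise_diff _ _ R
    (fun a => (a \*o idfun : {additive R -> R})) _ (fun i => v i 0)
    (fun i => v i 0)) => [|u w z|//]; last by rewrite /= mulrBl.
  under [leRHS]eq_bigr do under eq_bigr do rewrite yE.
  rewrite -laplacian_energy card_ord -dotE mulrCA ler_pM2l; first exact: l_le.
  by rewrite mulr_gt0.
have coords (w : 'I_q -> 'I_q -> R) :
    \sum_i \sum_j w i j * dot (x i - x j) (x i - x j)
    = \sum_k \sum_i \sum_j w i j * (x i k 0 - x j k 0) ^+ 2.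
  rewrite [RHS]exchange_big /=; apply: eq_bigr => i _.
  rewrite [RHS]exchange_big /=; apply: eq_bigr => j _.
  by rewrite dotE mulr_sumr; apply: eq_bigr => k _; rewrite !mxE.
have -> : \sum_i \sum_j dot (x i - x j) (x i - x j)
          = \sum_k \sum_i \sum_j (x i k 0 - x j k 0) ^+ 2.
  transitivity (\sum_i \sum_j 1 * dot (x i - x j) (x i - x j)).
    by apply: eq_bigr => i _; apply: eq_bigr => j _; rewrite mul1r.
  rewrite (coords (fun _ _ => 1)).
  by do 3! (apply: eq_bigr => ? _); rewrite mul1r.
by rewrite coords mulr_sumr; apply: ler_sum => k _; exact: scalar_case.
Qed.

End Laplacian.

Lemma lyapunov_bform (R : realType) (n : nat) (A P : 'M[R]_n) (y : 'cV[R]_n) :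
  P^T = P -> bform (A^T *m P + P *m A) y y = 2 * bform P y (A *m y).
Proof.
move=> symP; rewrite bformD.
have -> : A^T *m P = (P *m A)^T by rewrite trmx_mul symP.
by rewrite bform_trmx bform_mulmx; ring.
Qed.

(** * Energy balance of the coupled systems *)

Section Coupling.
Context {R : realType} {q n : nat}.
Variable Q : 'I_q -> 'I_q -> 'M[R]_n.
Hypothesis Q_sym : forall i j, Q j i = Q i j.
Implicit Types x : 'I_q -> 'cV[R]_n.

(** The action of agent [j] on agent [i], up to the gain [alpha] and to [P]; it is
    antisymmetric, like a pair of opposite forces. *)
Let flux x i j := Q i j *m (x j - x i).

Let fluxN x i j : flux x j i = - flux x i j.
Proof. by rewrite /flux Q_sym -mulmxN opprB. Qed.

Lemma sum_flux x : \sum_i \sum_j flux x i j = 0.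
Proof.
set X := LHS.
have XN : X = - X.
  rewrite {1}/X exchange_big /= /X -sumrN; apply: eq_bigr => i _.
  by rewrite -sumrN; apply: eq_bigr => j _; rewrite fluxN.
apply/colP => k; move/colP/(_ k): XN; rewrite !mxE; lra.
Qed.

(** Two summations by parts: the total coupling [z] is zero, so the left-hand
    side is [4 q] times the sum of the [dot (x i) (z i)]; and the latter folds back
    into differences because the flux is antisymmetric. *)
Lemma coupling_dissipation x (a : R) (z : 'I_q -> 'cV[R]_n) :
  (forall i, z i = a *: \sum_j flux x i j) ->
  \sum_i \sum_j 2 * dot (x i - x j) (z i - z j)
  = - (2 * q%:R * a) * \sum_i \sum_j bform (Q i j) (x i - x j) (x i - x j).
Proof.
move=> zE.
have z0 : \sum_i z i = 0.
  by under eq_bigr do rewrite zE; rewrite -scaler_sumr sum_flux scaler0.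
have dotBl (u v w : 'cV[R]_n) : dot (u - v) w = dot u w - dot v w.
  exact: bformBl.
have Qsum : \sum_i \sum_j bform (Q i j) (x i - x j) (x i - x j)
            = - (2 * \sum_i dot (x i) (\sum_j flux x i j)).
  rewrite -(sum_antisym (b := bform 1%:M) dotBl x (fluxN x)) -sumrN.
  apply: eq_bigr => i _; rewrite -sumrN; apply: eq_bigr => j _.
  by rewrite bform_dot -raddfN /flux -mulmxN opprB.
under eq_bigr do rewrite -mulr_sumr.
rewrite -mulr_sumr (sum_pairwise_diff (b := bform 1%:M) dotBl x z0) card_ord Qsum.
under eq_bigr do rewrite zE /dot /= bformZr.
by rewrite -mulr_sumr /dot; ring.
Qed.

Lemma pair_energy_derivative (A P : 'M[R]_n) (a : R) x (u : 'I_q -> 'cV[R]_n) :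
  P^T = P -> (forall i, P *m u i = a *: \sum_j Q i j *m (x j - x i)) ->
  \sum_i \sum_j 2 * bform P (x i - x j) ((A *m x i + u i) - (A *m x j + u j))
  = \sum_i \sum_j bform (A^T *m P + P *m A) (x i - x j) (x i - x j)
    - 2 * q%:R * a * \sum_i \sum_j bform (Q i j) (x i - x j) (x i - x j).
Proof.
move=> symP uE; rewrite -mulNr -(coupling_dissipation uE) -big_split.
apply: eq_bigr => i _; rewrite -big_split; apply: eq_bigr => j _ /=.
rewrite lyapunov_bform// -mulrDr -mulmxBr -bform_dot -bformDr mulmxBr.
by congr (_ * bform _ _ _); rewrite opprD addrACA.
Qed.

(** Positivity of the [Q i j] allows lowering the gain [k] to 1 and dropping the
    coupling altogether outside the edges. *)
Lemma pair_energy_bound (e : rel 'I_q) (S : 'M[R]_n) (eps sigma k : R) x :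
  1 <= k ->
  (forall i j w, 0 <= bform (Q i j) w w) ->
  (forall i j w, e i j -> bform S w w - bform (Q i j) w w <= - (eps * dot w w)) ->
  (forall w, bform S w w <= sigma * dot w w) ->
  \sum_i \sum_j bform S (x i - x j) (x i - x j)
    - k * \sum_i \sum_j bform (Q i j) (x i - x j) (x i - x j)
  <= - eps * (\sum_i \sum_j (e i j)%:R * dot (x i - x j) (x i - x j))
     + sigma * (\sum_i \sum_j dot (x i - x j) (x i - x j)
                - \sum_i \sum_j (e i j)%:R * dot (x i - x j) (x i - x j)).
Proof.
move=> k1 Q_ge0 edge_le S_le; pose y i j := x i - x j.
apply: (@le_trans _ _ (\sum_i \sum_j
    (bform S (y i j) (y i j) - bform (Q i j) (y i j) (y i j)))).
  under [leRHS]eq_bigr do rewrite sumrB.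
  rewrite sumrB lerD2l lerN2 ler_peMl//.
  by apply: sumr_ge0 => i _; exact: sumr_ge0.
rewrite -sumrB !mulr_sumr -big_split /=; apply: ler_sum => i _.
rewrite -sumrB !mulr_sumr -big_split /=; apply: ler_sum => j _.
rewrite -/(y i j); case eij: (e i j) => /=.
  by have := edge_le _ _ (y i j) eij; lra.
by have := Q_ge0 i j (y i j); have := S_le (y i j); lra.
Qed.

End Coupling.

(** * Derivatives and exponential decay *)

Lemma is_derive_coord (R : realType) (n : nat) (f : R -> 'cV[R]_n) (t : R) df i :
  is_derive t 1 f df -> is_derive t 1 (fun s => f s i 0) (df i 0).
Proof.
move=> [fd fE]; split; first by move/derivable_mxP: fd => /(_ i 0).
by rewrite -fE derive_mx// mxE.
Qed.

Lemma is_derive_bform (R : realType) (n : nat) (M : 'M[R]_n)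
    (f : R -> 'cV[R]_n) (t : R) df :
  M^T = M -> is_derive t 1 f df ->
  is_derive t 1 (fun s => bform M (f s) (f s)) (2 * bform M (f t) df).
Proof.
move=> symM f_df.
have fi i := is_derive_coord i f_df.
have -> : (fun s => bform M (f s) (f s))
  = \sum_j \sum_i (fun s => f s i 0 * M i j * f s j 0).
  by apply/funext => s; rewrite bformE fct_sumE;
     apply: eq_bigr => j _; rewrite fct_sumE.
have -> : 2 * bform M (f t) df
  = \sum_j \sum_i (f t i 0 * M i j * df j 0 + df i 0 * M i j * f t j 0).
  rewrite mulr_natl mulr2n -{2}symM bform_trmx !bformE -big_split /=.
  by apply: eq_bigr => j _; rewrite -big_split.
apply: is_derive_sum => j; apply: is_derive_sum => i.
apply: (is_derive_eq
  (is_deriveM (is_deriveM (fi i) (is_derive_cst (M i j) t 1)) (fi j))).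
by rewrite /GRing.scale /= !fctE; ring.
Qed.

(** Gronwall: [V t * expR (c * t)] is nonincreasing for [t] at least 1.  Starting
    from time 1 rather than 0 keeps every point in the domain of
    differentiability. *)
Lemma exponential_decay (R : realType) (c : R) (V dV : R -> R) :
  0 < c -> (forall t : R, 0 < t -> is_derive t 1 V (dV t)) ->
  (forall t, 0 < t -> dV t <= - c * V t) -> (forall t, 0 <= V t) ->
  V t @[t --> +oo] --> 0.
Proof.
move=> c0 VdV dV_le V_ge0.
pose W s := V s * expR (c * s).
have W_dW (t : R) : 0 < t -> is_derive t 1 W ((dV t + c * V t) * expR (c * t)).
  move=> /VdV Vt.
  have exp_t : is_derive t 1 (fun s => expR (c * s)) (c * expR (c * t)).
    apply: (is_derive_eq (is_derive1_comp (is_derive_expR _)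
      (is_deriveM (is_derive_cst c t 1) (is_derive_id t 1)))).
    by rewrite /GRing.scale /= !fctE; ring.
  apply: (is_derive_eq (is_deriveM Vt exp_t)).
  by rewrite /GRing.scale /=; ring.
have W_le t : 1 <= t -> W t <= W 1.
  move=> t1.
  have pos s : s \in `[1, t] -> 0 < s.
    by rewrite in_itv/= => /andP[s1 _]; apply: lt_le_trans s1.
  have pos' s : s \in `]1, t[ -> 0 < s.
    by move=> s1t; apply: pos; apply: subset_itv_oo_cc s1t.
  apply: (@ler0_derive1_le_cc _ W 1 t) => //.
  - by move=> s /pos' /W_dW[].
  - move=> s /pos' s0; rewrite derive1E; have [_ ->] := W_dW s s0.
    rewrite pmulr_lle0 ?expR_gt0//; have := dV_le s s0; lra.
  - by apply: derivable_within_continuous => s /pos /W_dW[].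
  - by rewrite in_itv/= lexx t1.
  - by rewrite in_itv/= lexx t1.
apply: (@squeeze_cvgr _ _ _ _ (fun=> 0) (fun t => W 1 * expR (- (c * t)))).
- near=> t; rewrite V_ge0 /= expRN ler_pdivlMr ?expR_gt0//.
  by apply: W_le; near: t; exact: nbhs_pinfty_ge.
- exact: cvg_cst.
rewrite -[X in _ --> X](mulr0 (W 1)); apply: cvgM; first exact: cvg_cst.
apply: (cvg_comp (fun t => c * t) (fun u => expR (- u)) _ (@cvgr_expR R)).
by apply: gt0_cvgMry c0 _; exact: cvg_id.
Unshelve. all: by end_near. Qed.

(** For [sigma < 0] the pairs outside the edges only help, and the edges alone
    give the rate [eps * l].  Otherwise [E] enters with the coefficient
    [- (eps + sigma) <= 0], and replacing it by [l * T] gives the rate. *)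
Lemma decay_rate (R : realType) (eps sigma l : R) :
  0 < eps -> 0 < l -> (l^-1 - 1) * sigma < eps ->
  exists2 d, 0 < d & forall T E : R, l * T <= E -> E <= T ->
    - eps * E + sigma * (T - E) <= - d * T.
Proof.
move=> eps0 l0 h; have [s0|s0] := ltP sigma 0.
  exists (eps * l) => [|T E lTE ET]; first exact: mulr_gt0.
  have := ler_wpM2l (ltW eps0) lTE.
  have : sigma * (T - E) <= 0 by rewrite nmulr_rle0 ?subr_ge0.
  lra.
have ls : sigma < l * (eps + sigma).
  by rewrite -ltr_pdivrMl//; lra.
exists (l * (eps + sigma) - sigma) => [|T E lTE ET]; first lra.
have es0 : 0 <= eps + sigma.
  by rewrite -(pmulr_rge0 _ l0); apply: le_trans s0 (ltW ls).
have := ler_wpM2l es0 lTE; lra.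
Qed.

(** * Synchronization *)

Lemma eqmx_rows_neq0 (R : realType) (m1 m2 n : nat)
    (M : 'M[R]_(m1, n)) (N : 'M[R]_(m2, n)) :
  eqmx_rows M N -> (N != 0) = (M != 0).
Proof. by case=> e; case: m2 / e N => N; rewrite castmx_id => <-. Qed.

Lemma eqmx_rows_gram (R : realType) (m1 m2 n : nat)
    (M : 'M[R]_(m1, n)) (N : 'M[R]_(m2, n)) :
  eqmx_rows M N -> N^T *m N = M^T *m M.
Proof. by case=> e; case: m2 / e N => N; rewrite castmx_id => <-. Qed.

Lemma connected_edge (q : nat) (e : rel 'I_q) :
  (2 <= q)%N -> connected_graph e -> exists ij : 'I_q * 'I_q, e ij.2 ij.1.
Proof.
move=> hq; move/(_ (Ordinal (ltnW hq)) (Ordinal hq)) => /connectP[[|j p]] //=.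
by case/andP=> ej _ _; exists (j, Ordinal (ltnW hq)).
Qed.

Lemma euclid_norm_dot (R : realType) (n : nat) (v : 'cV[R]_n) :
  euclid_norm v = Num.sqrt (dot v v).
Proof.
by rewrite /euclid_norm dotE; congr Num.sqrt; apply: eq_bigr => i _; rewrite expr2.
Qed.

Theorem theorem1 (R : realType) (q n : nat) (m : 'I_q -> 'I_q -> nat)
    (A : 'M[R]_n) (C : forall i j : 'I_q, 'M[R]_(m i j, n))
    (P : 'M[R]_n) (alpha : R)
    (hq : (2 <= q)%N)
    (hCdiag : forall i : 'I_q, C i i = 0)
    (hCsym : forall i j : 'I_q, eqmx_rows (C i j) (C j i))
    (hconn : connected_graph (edge C))
    (hP : posdefmx P)
    (hPC : forall i j : 'I_q, C i j != 0 ->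
       loewner_lt (A^T *m P + P *m A) ((C i j)^T *m C i j))
    (halpha : (2 * q%:R)^-1 <= alpha) :
  let G := fun i j : 'I_q => alpha *: (invmx P *m (C i j)^T) in
  let epsilon := least
    [set lambda_min ((C ij.1 ij.2)^T *m C ij.1 ij.2 - A^T *m P - P *m A)
      | ij in [set ij : 'I_q * 'I_q | C ij.1 ij.2 != 0]] in
  let sigma := lambda_max (A^T *m P + P *m A) in
  let Gamma := laplacian R (edge C) in
  ((lambda2 Gamma)^-1 - 1) * sigma < epsilon ->
  synchronize A G C.
Proof.
move=> G epsilon sigma Gamma h_eps x0 x sol i0 j0.
have q0 : 0 < q%:R :> R by rewrite ltr0n ltnW.
pose e := edge C.
have e_sym : symmetric e.
  by move=> i j; rewrite /e /edge (eqmx_rows_neq0 (hCsym i j)).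
have e_irr : irreflexive e by move=> i; rewrite /e /edge hCdiag eqxx.
have [ij0 eij0] : exists ij, C ij.1 ij.2 != 0 by exact: connected_edge hq hconn.
have n_gt0 : (0 < n)%N.
  rewrite lt0n; apply: contraNneq eij0 => n0; apply/eqP/matrixP => k l.
  by have := ltn_ord l; rewrite {2}n0.
have symP := hP.1.
pose S := A^T *m P + P *m A.
have symS : S^T = S by rewrite linearD /= !trmx_mul trmxK symP addrC.
pose Q i j := (C i j)^T *m C i j.
have Q_sym i j : Q j i = Q i j by exact: eqmx_rows_gram.
have QS i j : Q i j - A^T *m P - P *m A = Q i j - S.
  by rewrite /S opprD addrA.
have [[ij eij epsE] eps_le] :=
  least_finite_image (fun ij => lambda_min (Q ij.1 ij.2 - A^T *m P - P *m A))
    (ex_intro (fun ij => C ij.1 ij.2 != 0) ij0 eij0).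
rewrite -/epsilon in epsE eps_le.
have posQS i j : C i j != 0 -> posdefmx (Q i j - S) by exact: hPC.
have eps_gt0 : 0 < epsilon.
  by rewrite epsE QS; apply: posdef_lambda_min_gt0 => //; exact: posQS.
have edge_bound i j (w : 'cV[R]_n) : e i j ->
    bform S w w - bform (Q i j) w w <= - (epsilon * dot w w).
  rewrite e_sym => Cij; have [symQS _] := posQS _ _ Cij.
  have := (lambda_minP n_gt0 symQS).2 w.
  have := ler_wpM2r (dot_ge0 w) (eps_le (i, j) Cij).
  by rewrite /= QS (bformD (Q i j)) bformN; lra.
have [l_gt0 _] := @laplacian_lambda2 R _ _ e_sym e_irr hconn hq.
have [d d_gt0 rate] := decay_rate eps_gt0 l_gt0 h_eps.
pose y i j t := x i t - x j t.
pose u i t := \sum_j G i j *m C i j *m (x j t - x i t).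
pose dy i j t := (A *m x i t + u i t) - (A *m x j t + u j t).
pose V t := \sum_i \sum_j bform P (y i j t) (y i j t).
pose dV t := \sum_i \sum_j 2 * bform P (y i j t) (dy i j t).
pose T t := \sum_i \sum_j dot (y i j t) (y i j t).
have T_ge0 t : 0 <= T t.
  by apply: sumr_ge0 => i _; apply: sumr_ge0 => j _; exact: dot_ge0.
pose pmin := lambda_min P; pose pmax := lambda_max P.
have pmin_gt0 : 0 < pmin by exact: posdef_lambda_min_gt0.
have [[v v0 _] pmin_le] := lambda_minP n_gt0 symP.
have le_pmax := bform_le_lambda_max n_gt0 symP.
have pmax_gt0 : 0 < pmax.
  rewrite -(pmulr_lgt0 _ (dot_gt0 v0)); apply: lt_le_trans (le_pmax v).
  by apply: lt_le_trans (pmin_le v); rewrite mulr_gt0 ?dot_gt0.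
have V_le t : V t <= pmax * T t.
  rewrite mulr_sumr; apply: ler_sum => i _; rewrite mulr_sumr.
  by apply: ler_sum => j _; exact: le_pmax.
have le_V t : pmin * T t <= V t.
  rewrite mulr_sumr; apply: ler_sum => i _; rewrite mulr_sumr.
  by apply: ler_sum => j _; exact: pmin_le.
have uE t i : P *m u i t = alpha *: \sum_j Q i j *m (x j t - x i t).
  rewrite mulmx_sumr scaler_sumr; apply: eq_bigr => j _.
  by rewrite /G -!scalemxAl -scalemxAr !mulmxA mulmxV ?posdef_unitmx// mul1mx.
have alphaq : 1 <= 2 * q%:R * alpha.
  by rewrite -ler_pdivrMl ?mulr_gt0// mulr1.
have Q_ge0 i j (w : 'cV[R]_n) : 0 <= bform (Q i j) w w.
  by rewrite /Q -{2}[C i j]trmxK gram_psd dot_ge0.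
have dV_le t : dV t <= - d * T t.
  rewrite /dV /dy (pair_energy_derivative Q_sym A symP (uE t)).
  apply: le_trans (pair_energy_bound (x ^~ t) alphaq Q_ge0 edge_bound
    (bform_le_lambda_max n_gt0 symS)) _.
  apply: rate; first exact: (lambda2_poincare e_sym e_irr hconn hq (x ^~ t)).
  apply: ler_sum => i _; apply: ler_sum => j _.
  by rewrite ler_piMl ?dot_ge0//; case: (e i j).
have V_dV (t : R) : 0 < t -> is_derive t 1 V (dV t).
  move=> t0.
  have -> : V = \sum_i \sum_j (fun s => bform P (y i j s) (y i j s)).
    by apply/funext => s; rewrite /V fct_sumE;
       apply: eq_bigr => i _; rewrite fct_sumE.
  apply: is_derive_sum => i; apply: is_derive_sum => j.
  apply: is_derive_bform => //.
  have [_ _ /(_ t t0) xi] := sol i; have [_ _ /(_ t t0) xj] := sol j.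
  exact: (is_deriveB xi xj).
have V_cvg : V t @[t --> +oo] --> 0.
  apply: (@exponential_decay _ (d / pmax) V dV) => //.
  - by rewrite divr_gt0.
  - move=> t _; apply: le_trans (dV_le t) _.
    rewrite !mulNr lerN2 -mulrA ler_pM2l// ler_pdivrMl//.
  - by move=> t; apply: le_trans (le_V t); rewrite mulr_ge0// ltW.
have dot_cvg : dot (y i0 j0 t) (y i0 j0 t) @[t --> +oo] --> 0.
  apply: (@squeeze_cvgr _ _ _ _ (fun=> 0) (fun t => pmin^-1 * V t)).
  - near=> t; rewrite dot_ge0 /= ler_pdivlMl//; apply: le_trans (le_V t).
    rewrite ler_pM2l// /T (bigD1 i0)//= (bigD1 j0)//= -addrA lerDl addr_ge0//.
      by apply: sumr_ge0 => j _; exact: dot_ge0.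
    by apply: sumr_ge0 => i _; apply: sumr_ge0 => j _; exact: dot_ge0.
  - exact: cvg_cst.
  - by rewrite -[X in _ --> X](mulr0 pmin^-1); apply: cvgM => //; exact: cvg_cst.
under eq_fun do rewrite euclid_norm_dot.
have : Num.sqrt (dot (y i0 j0 t) (y i0 j0 t)) @[t --> +oo] --> Num.sqrt (0 : R).
  by apply: continuous_cvg => //; exact: sqrt_continuous.
by rewrite sqrtr0.
Unshelve. all: by end_near. Qed.
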